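(* The Weighted Least Remaining Loops First (WLRL) rule has a worst-case performance ratio of $\frac12(1+\sqrt2)$: for every instance $I$ of the reentrant flow shop problem with unit processing times, every schedule $\sigma$ generated by WLRL for $I$ satisfies $$\sum_{j=1}^n w_jC_j(\sigma)\ \le\ \frac{1+\sqrt2}{2}\ \min_{\sigma'}\sum_{j=1}^n w_jC_j(\sigma'),$$ where the minimum is over all schedules $\sigma'$ of $I$.
   Context: Reentrant flow shop with unit processing times: there are $m\ge 1$ machines in series and $n$ jobs. Job $j$ must traverse the shop $\mathcal{L}_j\ge 1$ times (loops $k=1,\dots,\mathcal{L}_j$, with $\mathcal{L}_j$ an integer) and has weight $w_j>0$. In each loop it is processed for one time unit on each of the machines $1,2,\dots,m$ in this order. Once a loop is started on machine $1$ it proceeds through all machines without waiting. A schedule is an assignment of start times $S_{jk}\in\{0,1,2,\dots\}$ on machine $1$ to all loops $(j,k)$ such that distinct loops have distinct start times and $S_{jk}\ge C_{j,k-1}$ for $k\ge 2$, where $C_{jk}=S_{jk}+m$ is the completion time of loop $k$ of job $j$ on machine $m$. The completion time of job $j$ is $C_j=C_{j\mathcal{L}_j}$; $C_j(\sigma)$ denotes its value in schedule $\sigma$. Job $j$ is available at time $t$ if it still has loops that have not been started before $t$ and all its previously started loops are completed on machine $m$ by time $t$. Its number of remaining loops at that time is the number of its loops not yet started. The WLRL priority rule: at each time $t=0,1,2,\dots$ at which at least one job is available, start on machine $1$ the next loop of an available job with the highest ratio of weight $w_j$ to its number of remaining loops among all available jobs (ties broken arbitrarily); machine $1$ is idle only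 if no job is available. *)

(* Defs.v *)
From HB Require Import structures.
From mathcomp Require Import all_boot all_order all_algebra reals.
Set Implicit Arguments.
Unset Strict Implicit.
Unset Printing Implicit Defensive.
Import Order.TTheory GRing.Theory Num.Theory.
Local Open Scope ring_scope.

(* Jobs are indexed by 'I_n, machine count is m, and job j has loops
   k = 1, ..., L j.  Start times on machine 1 are given by
   S : 'I_n -> nat -> nat; only the values S j k with 1 <= k <= L j matter. *)

Definition is_loop (n : nat) (L : 'I_n -> nat) (j : 'I_n) (k : nat) : bool :=
  (1 <= k <= L j)%N.

Definition loop_completion (n : nat) (m : nat) (S : 'I_n -> nat -> nat)
    (j : 'I_n) (k : nat) : nat :=
  (S j k + m)%N.

Definition is_schedule (n m : nat) (L : 'I_n -> nat) (S : 'I_n -> nat -> nat)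
    : Prop :=
  (forall i j k l, is_loop L i k -> is_loop L j l ->
     S i k = S j l -> i = j /\ k = l) /\
  (forall j k, is_loop L j k -> (2 <= k)%N ->
     (loop_completion m S j k.-1 <= S j k)%N).

Definition job_completion (n m : nat) (L : 'I_n -> nat)
    (S : 'I_n -> nat -> nat) (j : 'I_n) : nat :=
  loop_completion m S j (L j).

Definition weighted_completion (R : realType) (n m : nat) (L : 'I_n -> nat)
    (w : 'I_n -> R) (S : 'I_n -> nat -> nat) : R :=
  \sum_(j < n) w j * (job_completion m L S j)%:R.

Definition remaining_loops (n : nat) (L : 'I_n -> nat)
    (S : 'I_n -> nat -> nat) (j : 'I_n) (t : nat) : nat :=
  count (fun k => t <= S j k)%N (iota 1 (L j)).

Definition available (n m : nat) (L : 'I_n -> nat) (S : 'I_n -> nat -> nat)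
    (j : 'I_n) (t : nat) : Prop :=
  (exists k, is_loop L j k /\ (t <= S j k)%N) /\
  (forall k, is_loop L j k -> (S j k < t)%N ->
     (loop_completion m S j k <= t)%N).

Definition priority (R : realType) (n : nat) (L : 'I_n -> nat)
    (w : 'I_n -> R) (S : 'I_n -> nat -> nat) (j : 'I_n) (t : nat) : R :=
  w j / (remaining_loops L S j t)%:R.

(* The schedule may be generated by WLRL, for some way of breaking ties.  The
   loop started at t is the next loop of its job, since start times increase
   with k in a schedule when 0 < m. *)
Definition wlrl_schedule (R : realType) (n m : nat) (L : 'I_n -> nat)
    (w : 'I_n -> R) (S : 'I_n -> nat -> nat) : Prop :=
  is_schedule m L S /\
  (forall t : nat, (exists i, available m L S i t) ->
     exists j k, [/\ is_loop L j k, S j k = t, available m L S j t &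
       forall i, available m L S i t ->
         priority L w S i t <= priority L w S j t]).

Definition optimal_schedule (R : realType) (n m : nat) (L : 'I_n -> nat)
    (w : 'I_n -> R) (S : 'I_n -> nat -> nat) : Prop :=
  is_schedule m L S /\
  (forall S' : 'I_n -> nat -> nat, is_schedule m L S' ->
     weighted_completion m L w S <= weighted_completion m L w S').

(* Main.v *)
Require Import Defs.
From HB Require Import structures.
From mathcomp Require Import all_boot all_order all_algebra boolp reals.
From mathcomp Require Import zify ring lra.
Set Implicit Arguments.
Unset Strict Implicit.
Unset Printing Implicit Defensive.
Import Order.TTheory GRing.Theory Num.Theory.
Local Open Scope ring_scope.

(** Why the bound holds. Write s for the square root of 2 and c = (1 + s) / 2.

    WLRL never interrupts a job: starting a loop only raises the ratio of its
    job, so when the loop is completed the job beats every job that was waiting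
    at its start ([wlrl_nowait]). WLRL is thus list scheduling in order of
    nonincreasing w_j / L_j ([wlrl_ratio_sorted]). Writing w_j as
    (w_j / L_j) L_j and summing by parts ([weighted_sum_ge0_of_prefix]), it is
    enough to compare the two schedules with weights L_j on each prefix P of
    the WLRL starting order ([wlrl_prefix_length_cost]).

    With weights L_j one has L_j C_j >= sum_k S_jk + m L_j (L_j + 1) / 2 in
    every schedule, with equality when job j never waits between its loops. So
    everything is about sums of start times of loops.

    - Let F - 1 be the time at which the last job of P starts under WLRL. Every
      time before F is used by a loop of P ([wlrl_prefix_busy]). The y_j
      loops of job j that start at F or later follow each other at distance m,
      the first of them before F + m.
    - In any schedule, write S = G - (G - S)^+ + (S - G)^+ for a real G. Start
      times are distinct, so the (G - S)^+ sum to at most (G + 1/2)^2 / 2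
      ([sum_ramp_down_le]), and the (k+1)-st loop of a job starts at k m or
      later, which bounds the (S - G)^+ from below
      ([schedule_length_cost_ge]).

    The choice G = s F - 1/2 makes the terms in F alone cancel, and the
    remaining difference splits into one term per job. Each such term is
    nonnegative ([job_slack]): up to lower order terms it is a perfect
    square, which is where the constant c comes from. *)

(** * Two sums of positive parts and the per-job inequality *)

(** Peeling off the term t = 0 replaces G by G - 1, and
    G + (G - 1/2)^2 / 2 = (G + 1/2)^2 / 2, so induction on T loses nothing until
    G drops below 1/2. *)
Lemma sum_ramp_down_le (R : realType) (G : R) (T : nat) :
  - 2^-1 <= G ->
  \sum_(t < T) Num.max 0 (G - t%:R) <= (G + 2^-1) ^+ 2 / 2.
Proof.
elim: T G => [|T IHT] G hG; first by rewrite big_ord0; nra.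
rewrite big_ord_recl /= subr0.
under eq_bigr => t _ do rewrite /bump /= natrD opprD addrA.
have [hG2|hG2] := lerP (2^-1) G.
  have hmax : Num.max 0 G = G by apply/max_idPr; lra.
  have h1 : - 2^-1 <= G - 1 by lra.
  by have := IHT _ h1; rewrite hmax; nra.
rewrite big1 => [|t _]; last by apply/max_idPl; have := ler0n R t; lra.
by rewrite addr0 ge_max; apply/andP; split; nra.
Qed.

(** Passing from y to y + 1 increases the left-hand side by exactly
    y + 1 - g, the new term of the sum; for the first relevant y the left-hand
    side is nonpositive. *)
Lemma sum_ramp_up_ge (R : realType) (g : R) (y : nat) :
  0 <= g -> g <= y%:R + 1 ->
  (y%:R - g) * (y%:R - g + 1) / 2 <= \sum_(k < y.+1) Num.max 0 (k%:R - g).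
Proof.
move=> g0; elim: y => [|y IHy] hg.
  rewrite big_ord_recl big_ord0 /= addr0.
  have : 0 <= Num.max 0 (0 - g) by rewrite le_max lexx.
  by nra.
rewrite big_ord_recr /=.
have hy : (y.+1)%:R = y%:R + 1 :> R by rewrite -natr1.
rewrite hy in hg *.
have hmax : y%:R + 1 - g <= Num.max 0 (y%:R + 1 - g) by rewrite le_max lexx orbT.
have hmax0 : 0 <= Num.max 0 (y%:R + 1 - g) by rewrite le_max lexx.
have [hgy|hgy] := lerP g (y%:R + 1); first by have := IHy hgy; nra.
have : 0 <= \sum_(k < y.+1) Num.max 0 (k%:R - g).
  by apply: sumr_ge0 => k _; rewrite le_max lexx.
by nra.
Qed.

(** The inequality behind the ratio, in units of m: g stands for s F / m and y
    for the number of loops that a job has left at time F. If g < y, then with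
    u = y - g the quadratic part is (1 + s) (u - (s - 1) y)^2 / 2, a square
    because s^2 = 2; to leading order the worst case is y = (1 + s / 2) g. *)
Lemma ramp_tradeoff (R : realType) (s g : R) (y : nat) :
  0 <= s -> s ^+ 2 = 2 -> 0 <= g ->
  0 <= y%:R * g + (1 + s) * \sum_(k < y.+1) Num.max 0 (k%:R - g)
       + (s - 1) / 2 * ((y%:R + 1) * (y%:R + 2)) - y%:R * (y%:R + 1).
Proof.
move=> s0 s2 g0.
have s_lb : 7 / 5 <= s by nra.
have s_ub : s <= 3 / 2 by nra.
have y0 := ler0n R y.
have [hgy|hgy] := lerP y%:R g.
  have : 0 <= \sum_(k < y.+1) Num.max 0 (k%:R - g).
    by apply: sumr_ge0 => k _; rewrite le_max lexx.
  set z := (X in 0 <= X) => z0.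
  have : 0 <= (1 + s) * z by apply: mulr_ge0 => //; lra.
  have : y%:R * y%:R <= y%:R * g by rewrite ler_wpM2l.
  have : 0 <= (s - 7/5) * ((y%:R + 1) * (y%:R + 2)) by apply: mulr_ge0; nra.
  have := sqr_ge0 (y%:R - 1 : R).
  rewrite -/z; lra.
have hg1 : g <= y%:R + 1 by lra.
have := sum_ramp_up_ge g0 hg1.
set z := (X in _ <= X) => hz; rewrite -/z.
have hz' : (1 + s) * ((y%:R - g) * (y%:R - g + 1) / 2) <= (1 + s) * z.
  by rewrite ler_wpM2l //; lra.
pose u := y%:R - g.
have hg : g = y%:R - u by rewrite /u; ring.
rewrite hg in hz' *.
(* The shift 1/2 completes the square with the linear term in u included. *)
have hsq : 0 <= (1 + s) * (u - (s - 1) * y%:R + 2^-1) ^+ 2.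
  by rewrite mulr_ge0 ?sqr_ge0 //; lra.
have hE : (1 + s) * (u - (s - 1) * y%:R + 2^-1) ^+ 2 =
  (1 + s) * u ^+ 2 + (s - 1) * y%:R ^+ 2 + (1+s) / 4 - 2 * u * y%:R + (1 + s) * u - y%:R
  + (s ^+ 2 - 2) * ( (s - 1) * y%:R ^+ 2 - 2 * u * y%:R - y%:R).
  by field.
rewrite s2 subrr mul0r addr0 in hE.
have : 0 <= (s - 7/5) * y%:R by apply: mulr_ge0; lra.
rewrite hE in hsq.
nra.
Qed.

(** What one job with a loops before F and y loops from F on contributes to
    twice the difference between c times the lower bound for an arbitrary
    schedule and the WLRL cost, once the part that the times before F contribute
    is set aside. The term in a pays for the discrepancy (s - 1) F / 2 between
    sums over integer times and their quadratic approximations, as the a of all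
    jobs add up to at least F. *)
Lemma job_slack (R : realType) (s G : R) (m a y F : nat) :
  0 <= s -> s ^+ 2 = 2 -> (0 < m)%N -> (0 < a)%N ->
  G = s * F%:R - 2^-1 ->
  0 <= (1 + s) * y%:R * G
       + (1 + s) * \sum_(k < a + y) Num.max 0 ((k * m)%:R - G)
       + (s - 1) / 2 * (m * (a + y) * (a + y).+1)%:R
       - (2 * y%:R * (F%:R - 1) + (m * y * y.+1)%:R) - (s - 1) / 2 * a%:R.
Proof.
move=> s0 s2 m0 a0 GE.
have s_lb : 7 / 5 <= s by nra.
have s_ub : s <= 3 / 2 by nra.
have hm : 1 <= m%:R :> R by rewrite ler1n.
have ha : 1 <= a%:R :> R by rewrite ler1n.
have y0 := ler0n R y.
pose g : R := s * F%:R / m%:R.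
have m0' : 0 < m%:R :> R by lra.
have hgm : s * F%:R = m%:R * g by rewrite /g mulrCA divff ?mulr1 // gt_eqF.
have g0 : 0 <= g by rewrite /g divr_ge0 // mulr_ge0.
(* As a >= 1, the terms k = 0, ..., y are available on the right. *)
have hsum : m%:R * \sum_(k < y.+1) Num.max 0 (k%:R - g) <=
            \sum_(k < a + y) Num.max 0 ((k * m)%:R - G).
  rewrite mulr_sumr -(prednK a0) addSn -addnS addnC big_split_ord /=.
  rewrite -[X in X <= _]addr0 lerD //; last first.
    by apply: sumr_ge0 => k _; rewrite le_max lexx.
  apply: ler_sum => k _; rewrite maxr_pMr // mulr0.
  rewrite ge_max !le_max lexx /= natrM GE hgm; apply/orP; right; nra.
have ht := ramp_tradeoff y s0 s2 g0.
move: hsum ht; set z := \sum_(k < y.+1) _; set Z := \sum_(k < a + y) _; rewrite -?/z -?/Z.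
move=> hsum ht.
have hmt := mulr_ge0 (ltW m0') ht.
have hZ : (1 + s) * (m%:R * z) <= (1 + s) * Z by rewrite ler_wpM2l //; lra.
rewrite !natrM -(natr1 y) -(natr1 (a + y)) natrD.
have hG : (1 + s) * y%:R * G = 2 * F%:R * y%:R + m%:R * g * y%:R - (1 + s) / 2 * y%:R.
  rewrite GE -hgm.
  have -> : 2 * F%:R * y%:R = s ^+ 2 * F%:R * y%:R by rewrite s2.
  by field.
rewrite hG.
(* Every loop before F beyond the first one pays for itself. *)
have haa : 0 <= (s - 1) / 2 * (m%:R * (a%:R - 1) * (2 * y%:R + a%:R + 2) - (a%:R - 1)).
  apply: mulr_ge0; first by lra.
  have : 0 <= (m%:R - 1) * (a%:R - 1) * (2 * y%:R + a%:R + 2) :> R.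
    by apply: mulr_ge0; [apply: mulr_ge0|]; lra.
  have : 0 <= (a%:R - 1) * (2 * y%:R + a%:R + 1) :> R by apply: mulr_ge0; lra.
  lra.
have [y_0|y1] := posnP y.
  subst y.
  have hz : 0 <= z by apply: sumr_ge0 => k _; rewrite le_max lexx.
  have : 0 <= (1 + s) * (m%:R * z) by apply: mulr_ge0; [|apply: mulr_ge0]; lra.
  have : 0 <= (s - 1) * (m%:R - 1) by apply: mulr_ge0; lra.
  lra.
have hy1 : 1 <= y%:R :> R by rewrite ler1n.
have : 0 <= (3 / 2 - s) * (y%:R - 1) by apply: mulr_ge0; lra.
lra.
Qed.

(** * Completion times in arbitrary schedules *)

Lemma schedule_gap (n m : nat) (L : 'I_n -> nat) (S : 'I_n -> nat -> nat)
    (j : 'I_n) (k l : nat) :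
  is_schedule m L S -> (1 <= k)%N -> (k <= l)%N -> (l <= L j)%N ->
  (S j k + (l - k) * m <= S j l)%N.
Proof.
move=> [_ prec] k1; elim: l => [|l IHl] kl lL; first by lia.
have [->|{}kl] : k = l.+1 \/ (k <= l)%N by lia.
  by rewrite subnn mul0n addn0.
have := prec j l.+1; rewrite /is_loop /loop_completion /= lL ltnS.
move=> /(_ isT (leq_trans k1 kl)) hl.
by have := IHl kl (ltnW lL); rewrite subSn // mulSn; lia.
Qed.

Lemma schedule_mono (n m : nat) (L : 'I_n -> nat) (S : 'I_n -> nat -> nat)
    (j : 'I_n) (k l : nat) :
  is_schedule m L S -> (1 <= k)%N -> (k <= l)%N -> (l <= L j)%N ->
  (S j k <= S j l)%N.
Proof.
by move=> hS k1 kl lL; apply: leq_trans (schedule_gap hS k1 kl lL); apply: leq_addr.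
Qed.

Lemma sum_countdown (L m : nat) :
  (\sum_(k < L) 2 * ((L - k) * m) = m * L * L.+1)%N.
Proof.
elim: L => [|L IHL]; first by rewrite big_ord0 muln0.
rewrite big_ord_recl /= subn0.
under eq_bigr => k _ do rewrite /bump /= add1n subSS.
by rewrite IHL; ring.
Qed.

(** From the completion of its k-th loop on, job j still needs m time units for
    each later loop; the inequality sums this over k. *)
Lemma length_completion_ge (n m : nat) (L : 'I_n -> nat)
    (S : 'I_n -> nat -> nat) (j : 'I_n) :
  is_schedule m L S ->
  (\sum_(k < L j) 2 * S j k.+1 + m * L j * (L j).+1 <=
   2 * (L j * job_completion m L S j))%N.
Proof.
move=> hS; rewrite -sum_countdown -big_split /=.
rewrite [leqRHS]mulnCA -[X in (X * _)%N](card_ord (L j)) -sum_nat_const; apply: leq_sum => k _.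
have := schedule_gap hS (ltn0Sn k) (ltn_ord k) (leqnn _).
rewrite /job_completion /loop_completion.
have -> : (L j - k = (L j - k.+1).+1)%N by have := ltn_ord k; lia.
by rewrite mulSn; lia.
Qed.

Lemma length_completion_nowait (n m : nat) (L : 'I_n -> nat)
    (S : 'I_n -> nat -> nat) (j : 'I_n) :
  (forall k, (k < L j)%N -> S j k.+1 = (S j 1 + k * m)%N) ->
  (2 * (L j * job_completion m L S j) =
   \sum_(k < L j) 2 * S j k.+1 + m * L j * (L j).+1)%N.
Proof.
move=> nowait; rewrite -sum_countdown -big_split /=.
rewrite [LHS]mulnCA -[X in (X * _)%N](card_ord (L j)) -sum_nat_const; apply: eq_bigr => k _.
rewrite /job_completion /loop_completion nowait //.
have kL := ltn_ord k; have := nowait (L j).-1.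
rewrite prednK ?(leq_ltn_trans _ kL) // => ->; last by lia.
have -> : (L j - k = ((L j).-1 - k).+1)%N by lia.
have kl : (k <= (L j).-1)%N by lia.
by rewrite [(_.+1 * m)%N]mulSn -{1}(subnK kl) mulnDl; lia.
Qed.

(** * WLRL as list scheduling *)

Lemma remaining_loopsE (n : nat) (L : 'I_n -> nat) (S : 'I_n -> nat -> nat)
    (j : 'I_n) (t k : nat) :
  (k <= L j)%N ->
  (forall l, (1 <= l <= k)%N -> (S j l < t)%N) ->
  (forall l, (k < l <= L j)%N -> (t <= S j l)%N) ->
  remaining_loops L S j t = (L j - k)%N.
Proof.
move=> kL before after; rewrite /remaining_loops.
rewrite -{1}(subnKC kL) iotaD count_cat.
rewrite (eq_in_count (a2 := pred0)) ?count_pred0; last first.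
  by move=> l; rewrite mem_iota => hl /=; apply/negbTE; rewrite -ltnNge before //; lia.
rewrite (eq_in_count (a2 := predT)) ?count_predT ?size_iota //.
by move=> l; rewrite mem_iota => hl /=; rewrite after //; lia.
Qed.

Lemma unstarted_available (n m : nat) (L : 'I_n -> nat)
    (S : 'I_n -> nat -> nat) (j : 'I_n) (t : nat) :
  is_schedule m L S -> (1 <= L j)%N -> (t <= S j 1)%N ->
  available m L S j t /\ remaining_loops L S j t = L j.
Proof.
move=> hS L1 tS.
have later k : (1 <= k <= L j)%N -> (t <= S j k)%N.
  by move=> /andP[k1 kL]; apply: leq_trans tS (schedule_mono hS _ k1 kL).
split; last by rewrite (@remaining_loopsE n L S j t 0) ?subn0 // => l; lia.
split; first by exists 1%N; rewrite /is_loop leqnn.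
by move=> k hk; rewrite ltnNge later.
Qed.

(** The rule asserts that some loop starting at the given time has the highest
    priority; distinctness of start times makes it the loop (j, k). *)
Lemma wlrl_starts_first (R : realType) (n m : nat) (L : 'I_n -> nat)
    (w : 'I_n -> R) (S : 'I_n -> nat -> nat) (i j : 'I_n) (k : nat) :
  wlrl_schedule m L w S -> is_loop L j k -> available m L S i (S j k) ->
  priority L w S i (S j k) <= priority L w S j (S j k).
Proof.
move=> [[inj prec] rule] hk av.
have [|j' [k' [hk' eqS _ best]]] := rule (S j k); first by exists i.
by have [ej _] := inj _ _ _ _ hk' hk eqS; subst j'; apply: best.
Qed.

(** Strong induction on the start time t of the loop. At t + m job j is
    available; suppose that another job i is started instead. If i had been
    started before, its previous loop started before t (times are distinct), so
    by induction its next loop started before t + m. If i starts its first loop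
    at t + m, it was already available at t, where j won against it, and the
    ratio of j has strictly increased since. *)
Lemma wlrl_nowait_step (R : realType) (n m : nat) (L : 'I_n -> nat)
    (w : 'I_n -> R) (S : 'I_n -> nat -> nat) (j : 'I_n) (k : nat) :
  (1 <= m)%N -> (forall i, (1 <= L i)%N) -> (forall i, 0 < w i) ->
  wlrl_schedule m L w S -> (1 <= k)%N -> (k < L j)%N ->
  S j k.+1 = (S j k + m)%N.
Proof.
move=> m1 L1 w0 hw; have [hS rule] := hw; have [inj prec] := hS.
move eqt : (S j k) => t.
elim/ltn_ind: t j k eqt => t IHt j k eqt k1 kL.
have next : (t + m <= S j k.+1)%N.
  by have := schedule_gap hS k1 (leqnSn k) kL; rewrite subSnn eqt; lia.
have before l : (1 <= l <= k)%N -> (S j l <= t)%N.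
  move=> /andP[l1 lk].
  by rewrite -eqt; apply: schedule_mono hS l1 lk (ltnW kL).
have after l : (k < l <= L j)%N -> (S j k.+1 + (l - k.+1) * m <= S j l)%N.
  by move=> /andP[kl lL]; apply: schedule_gap hS _ kl lL.
have later l : (k < l <= L j)%N -> (t + m <= S j l)%N.
  by move=> /after; apply: leq_trans; apply: leq_trans next (leq_addr _ _).
have rem_later : remaining_loops L S j (t + m)%N = (L j - k)%N.
  apply: remaining_loopsE => [|l /before|l /later //]; first exact: ltnW.
  by lia.
have rem_now : remaining_loops L S j t = (L j - k.-1)%N.
  apply: remaining_loopsE => [|l hl|l hl]; first by lia.
    have l1 : (1 <= l)%N by lia.
    have lk : (l <= k)%N by lia.
    have := schedule_gap hS l1 lk (ltnW kL); rewrite eqt.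
    by apply: leq_trans; rewrite -addn1 leq_add2l muln_gt0; lia.
  have [->|lk] : l = k \/ (k < l <= L j)%N by lia.
    by rewrite eqt.
  by have := later l lk; lia.
have av : available m L S j (t + m).
  split; first by exists k.+1; rewrite /is_loop /= kL.
  move=> l hl lt; rewrite /loop_completion leq_add2r before //.
  have [//|lk] : (1 <= l <= k)%N \/ (k < l <= L j)%N by move: hl; rewrite /is_loop; lia.
  by have := later l lk; lia.
have [|i [l [hl eqi avi best]]] := rule (t + m)%N; first by exists j.
have [ij|ij] := eqVneq i j.
  subst i.
  have [lk|lk] : (1 <= l <= k)%N \/ (k < l <= L j)%N.
    by move: hl; rewrite /is_loop; lia.
    by have := before l lk; lia.
  have := after l lk; rewrite eqi => hlast.
  have : (l - k.+1 = 0)%N.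
    by apply/eqP; rewrite -leqn0 leqNgt; apply/negP => l0; nia.
  by move=> l0; have -> : k.+1 = l by lia.
have [l_1|l2] : l = 1%N \/ (2 <= l <= L i)%N by move: hl; rewrite /is_loop; lia.
  subst l.
  have [avt remt] : available m L S i t /\ remaining_loops L S i t = L i.
    by apply: unstarted_available => //; lia.
  have [_ remT] : available m L S i (t + m) /\ remaining_loops L S i (t + m) = L i.
    by apply: unstarted_available => //; lia.
  have hjk : is_loop L j k by rewrite /is_loop; lia.
  have := wlrl_starts_first hw hjk; rewrite eqt => /(_ i avt).
  have := best j av.
  rewrite /priority remt remT rem_later rem_now => h1 h2.
  have := le_trans h1 h2; rewrite leNgt ltr_pM2l // ltf_pV2 ?posrE ?ltr0n ?ltr_nat; lia.
have hprev : (S i l.-1 + m <= t + m)%N.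
  by have := prec i l hl; rewrite /loop_completion eqi; lia.
have hl' : is_loop L i l.-1 by rewrite /is_loop; lia.
have hjk : is_loop L j k by rewrite /is_loop; lia.
have neq : S i l.-1 <> t.
  by rewrite -eqt => /(inj _ _ _ _ hl' hjk)[eij _]; rewrite eij eqxx in ij.
have lt : (S i l.-1 < t)%N by lia.
have := IHt _ lt i l.-1 erefl; rewrite prednK; last by lia.
by move=> hil; have := hil ltac:(lia) ltac:(lia); lia.
Qed.

Lemma wlrl_nowait (R : realType) (n m : nat) (L : 'I_n -> nat)
    (w : 'I_n -> R) (S : 'I_n -> nat -> nat) (j : 'I_n) (k : nat) :
  (1 <= m)%N -> (forall i, (1 <= L i)%N) -> (forall i, 0 < w i) ->
  wlrl_schedule m L w S -> (k < L j)%N ->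
  S j k.+1 = (S j 1 + k * m)%N.
Proof.
move=> m1 L1 w0 hw; elim: k => [|k IHk] kL; first by rewrite mul0n addn0.
by rewrite (wlrl_nowait_step m1 L1 w0 hw) // IHk 1?ltnW // mulSn; lia.
Qed.

Lemma wlrl_ratio_sorted (R : realType) (n m : nat) (L : 'I_n -> nat)
    (w : 'I_n -> R) (S : 'I_n -> nat -> nat) (i j : 'I_n) :
  (forall i, (1 <= L i)%N) -> wlrl_schedule m L w S -> (S i 1 <= S j 1)%N ->
  w j / (L j)%:R <= w i / (L i)%:R.
Proof.
move=> L1 hw ij; have [hS _] := hw.
have [avj remj] := unstarted_available hS (L1 j) ij.
have [_ remi] := unstarted_available hS (L1 i) (leqnn _).
have hi : is_loop L i 1 by rewrite /is_loop leqnn L1.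
by have := wlrl_starts_first hw hi avj; rewrite /priority remj remi.
Qed.

(** As job i is available at t, some job is started at t, and its first loop
    starts no later than t, hence no later than that of i. *)
Lemma wlrl_prefix_busy (R : realType) (n m : nat) (L : 'I_n -> nat)
    (w : 'I_n -> R) (S : 'I_n -> nat -> nat) (i : 'I_n) (t : nat) :
  (forall i, (1 <= L i)%N) -> wlrl_schedule m L w S -> (t <= S i 1)%N ->
  exists2 j, (S j 1 <= S i 1)%N & exists2 k, (k < L j)%N & S j k.+1 = t.
Proof.
move=> L1 [hS rule] ti.
have [avi _] := unstarted_available hS (L1 i) ti.
have [|j [k [/andP[k1 kL] eqS _ _]]] := rule t; first by exists i.
exists j; last by exists k.-1; rewrite prednK.
by apply: leq_trans ti; rewrite -eqS; apply: schedule_mono hS _ k1 kL.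
Qed.

(** * Counting loops by start time *)

Lemma sum_delta (R : realType) (T x : nat) (f : nat -> R) :
  \sum_(t < T) (x == t :> nat)%:R * f t = if (x < T)%N then f x else 0.
Proof.
case: ltnP => hx.
  rewrite (bigD1 (Ordinal hx)) //= eqxx mul1r big1 ?addr0 // => t ht.
  by rewrite [x == t]eq_sym -val_eqE /= in ht *; rewrite (negbTE ht) mul0r.
rewrite big1 // => t _.
by have -> : (x == t :> nat) = false; rewrite ?mul0r //; have := ltn_ord t; lia.
Qed.

(** Regrouping a sum over loops by start time: the inner sum on the right counts
    the loops that start at t. It is at most 1 in a schedule, and at least 1
    when t is used. *)
Lemma loop_sum_tally (R : realType) (n : nat) (L : 'I_n -> nat)
    (S : 'I_n -> nat -> nat) (P : pred 'I_n) (T : nat) (f : nat -> R) :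
  \sum_(j | P j) \sum_(k < L j | (S j k.+1 < T)%N) f (S j k.+1) =
  \sum_(t < T) (\sum_(j | P j) \sum_(k < L j) (S j k.+1 == t)%:R) * f t.
Proof.
transitivity (\sum_(j | P j) \sum_(k < L j) \sum_(t < T)
    (S j k.+1 == t :> nat)%:R * f t).
  by apply: eq_bigr => j _; rewrite big_mkcond; apply: eq_bigr => k _; rewrite sum_delta.
under eq_bigr => j _ do rewrite exchange_big.
rewrite exchange_big; apply: eq_bigr => t _ /=.
by rewrite mulr_suml; apply: eq_bigr => j _; rewrite mulr_suml.
Qed.

Lemma distinct_sum_le (R : realType) (n m : nat) (L : 'I_n -> nat)
    (S : 'I_n -> nat -> nat) (P : pred 'I_n) (T : nat) (f : nat -> R) :
  is_schedule m L S -> (forall t, 0 <= f t) ->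
  \sum_(j | P j) \sum_(k < L j | (S j k.+1 < T)%N) f (S j k.+1) <=
  \sum_(t < T) f t.
Proof.
move=> [inj _] f0; rewrite loop_sum_tally; apply: ler_sum => t _.
rewrite ler_piMl // sig_big_dep /=.
case: (pickP [pred p : {j : 'I_n & 'I_(L j)} |
    P (tag p) && (S (tag p) (tagged p).+1 == t)]) => [p /andP[Pp /eqP hp]|none].
  rewrite (bigD1 p) ?Pp //= hp eqxx big1 ?addr0 // => q /andP[/andP[Pq _] qp].
  case: eqP => // hq; case/negP: qp; apply/eqP.
  case: p q hp hq {Pp Pq} => [j k] [i l] /= hp hq.
  have [] := @inj i j l.+1 k.+1; rewrite /is_loop ?ltn_ord //; first by rewrite hp hq.
  by move=> eij; subst i => -[/val_inj ->].
rewrite big1 // => q /andP[Pq _].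
by have := none q; rewrite /= Pq /= => ->.
Qed.

Lemma covered_sum_ge (R : realType) (n : nat) (L : 'I_n -> nat)
    (S : 'I_n -> nat -> nat) (P : pred 'I_n) (T : nat) :
  (forall t, (t < T)%N ->
     exists2 j, P j & exists2 k, (k < L j)%N & S j k.+1 = t) ->
  T%:R <= \sum_(j | P j) (\sum_(k < L j) (S j k.+1 < T)%N)%:R :> R.
Proof.
move=> cover.
have -> : \sum_(j | P j) (\sum_(k < L j) (S j k.+1 < T)%N)%:R =
          \sum_(j | P j) \sum_(k < L j | (S j k.+1 < T)%N) 1 :> R.
  apply: eq_bigr => j _; rewrite natr_sum [RHS]big_mkcond; apply: eq_bigr => k _.
  by case: ifP.
rewrite (loop_sum_tally L S P T (fun=> 1)).
have -> : T%:R = \sum_(t < T) 1 :> R by rewrite sumr_const card_ord.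
apply: ler_sum => t _; rewrite mulr1.
have [j Pj [k kL eqS]] := cover t (ltn_ord t).
rewrite (bigD1 j) //= (bigD1 (Ordinal kL)) //= eqS eqxx -addrA lerDl addr_ge0 //.
  by apply: sumr_ge0.
by apply: sumr_ge0 => i _; apply: sumr_ge0.
Qed.

(** A lower bound in the spirit of linear programming duality: the parameter G
    is free, and the best choice depends on the instance. *)
Lemma schedule_length_cost_ge (R : realType) (n m : nat) (L : 'I_n -> nat)
    (S : 'I_n -> nat -> nat) (P : pred 'I_n) (G : R) :
  is_schedule m L S -> - 2^-1 <= G ->
  \sum_(j | P j) (2 * (L j)%:R * G
      + 2 * \sum_(k < L j) Num.max 0 ((k * m)%:R - G)
      + (m * L j * (L j).+1)%:R) - (G + 2^-1) ^+ 2
  <= \sum_(j | P j) 2 * ((L j)%:R * (job_completion m L S j)%:R).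
Proof.
move=> hS hG; rewrite lerBlDr.
(* Loops starting at T or later do not contribute to the sum of (G - S)^+. *)
pose T := Num.bound `|G|.
have GT : G <= T%:R.
  exact: le_trans (ler_norm G) (ltW (archi_boundP (normr_ge0 G))).
have early : \sum_(j | P j) \sum_(k < L j) Num.max 0 (G - (S j k.+1)%:R)
             <= (G + 2^-1) ^+ 2 / 2.
  apply: le_trans (sum_ramp_down_le T hG).
  have f0 t : 0 <= Num.max 0 (G - t%:R) by rewrite le_max lexx.
  apply: le_trans (distinct_sum_le P T hS f0); apply: ler_sum => j _.
  rewrite [leRHS]big_mkcond; apply: ler_sum => k _.
  case: ltnP => // TS; rewrite ge_max lexx subr_le0 (le_trans GT) //.
  by rewrite ler_nat.
apply: le_trans (_ : \sum_(j | P j) (2 * ((L j)%:R * (job_completion m L S j)%:R)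
   + 2 * \sum_(k < L j) Num.max 0 (G - (S j k.+1)%:R)) <= _); last first.
  by rewrite big_split /= lerD2l -mulr_sumr; lra.
apply: ler_sum => j _.
have := length_completion_ge j hS; rewrite -(ler_nat R) natrD natr_sum !(natrM _ 2).
rewrite (natrM _ (L j)) => hC.
have hk : \sum_(k < L j) (2 * G + 2 * Num.max 0 ((k * m)%:R - G)) <=
  \sum_(k < L j) ((2 * S j k.+1)%:R + 2 * Num.max 0 (G - (S j k.+1)%:R)).
  apply: ler_sum => k _.
  have := schedule_gap hS (leqnn 1) (ltn0Sn k) (ltn_ord k).
  rewrite subn1 /= => hgap.
  have {}hgap : (k * m)%:R <= (S j k.+1)%:R :> R.
    by rewrite ler_nat; apply: leq_trans hgap; apply: leq_addl.
  rewrite natrM; case: (lerP 0 (_ - G)) => h1; case: (lerP 0 (G - _)) => h2; lra.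
rewrite !big_split /= sumr_const card_ord -!mulr_sumr -mulr_natl in hk.
move: hk hC; rewrite !natrM; lra.
Qed.

(** * The comparison with weights equal to lengths *)

(** Here b, b + m, ... are the start times of the L loops of a job without
    waiting. The last of the a terms below F is at most F - 1, so the i-th term
    from F on is at most F - 1 + i m. *)
Lemma progression_split (m F b L : nat) :
  (b < F)%N -> (1 <= L)%N ->
  exists a y, [/\ (a + y = L)%N, (1 <= a)%N,
    (\sum_(k < L) (b + k * m < F)%N)%N = a &
    (\sum_(k < L | F <= b + k * m) 2 * (b + k * m) <=
      2 * y * F.-1 + m * y * y.+1)%N].
Proof.
move=> bF L1.
(* The induction also needs to know where the last term lies. *)
suff [a [y [? ? ? ? _]]] : exists a y, [/\ (a + y = L)%N, (1 <= a)%N,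
    (\sum_(k < L) (b + k * m < F)%N)%N = a,
    (\sum_(k < L | F <= b + k * m) 2 * (b + k * m) <=
      2 * y * F.-1 + m * y * y.+1)%N &
    (b + L.-1 * m <= F.-1 + y * m)%N /\
    (y = 0%N \/ (F <= b + L.-1 * m)%N)].
  by exists a, y.
elim: L L1 => [//|[|L] IHL] _.
  exists 1%N, 0%N; split=> //.
  - by rewrite big_ord_recl big_ord0 /= mul0n !addn0 bF.
  - by rewrite big_pred0 // => k; rewrite ord1 mul0n addn0 leqNgt bF.
  by split; [rewrite /= !mul0n; lia | left].
have [//|a [y [aL a1 ea sum_y [last_y y_late]]]] := IHL.
rewrite [X in _ = X]/= in aL.
have lastS : (b + L.+1 * m = b + L * m + m)%N by rewrite mulSn; lia.
have [early|late] := ltnP (b + L.+1 * m) F.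
  exists a.+1, y; split=> //.
  - by lia.
  - by rewrite big_ord_recr /= ea early addn1.
  - by rewrite big_mkcond big_ord_recr -big_mkcond /= [(F <= b + _)%N]leqNgt early addn0.
  rewrite /= in last_y y_late *; split.
    by case: y_late => [-> | h]; rewrite ?mul0n; lia.
  by case: y_late => [|h]; [left | right; lia].
have hl : (b + L.+1 * m <= F.-1 + y.+1 * m)%N.
  by rewrite /= in last_y; rewrite lastS mulSn; lia.
exists a, y.+1; split=> //.
- by lia.
- by rewrite big_ord_recr /= ea ltnNge late addn0.
- rewrite big_mkcond big_ord_recr -big_mkcond /= late.
  apply: leq_trans (leq_add sum_y (leq_mul (leqnn 2) hl)) _.
  by rewrite leq_eqVlt; apply/orP; left; apply/eqP; ring.
by split=> //; right.
Qed.

Lemma wlrl_prefix_length_cost (R : realType) (n m : nat) (L : 'I_n -> nat)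
    (w : 'I_n -> R) (S S' : 'I_n -> nat -> nat) (i : 'I_n) :
  (1 <= m)%N -> (forall j, (1 <= L j)%N) -> (forall j, 0 < w j) ->
  wlrl_schedule m L w S -> is_schedule m L S' ->
  \sum_(j | (S j 1 <= S i 1)%N) (L j)%:R * (job_completion m L S j)%:R <=
  (1 + Num.sqrt 2) / 2 *
  \sum_(j | (S j 1 <= S i 1)%N) (L j)%:R * (job_completion m L S' j)%:R :> R.
Proof.
move=> m1 L1 w0 hw hS'; have [hS _] := hw.
pose P := [pred j | (S j 1 <= S i 1)%N].
pose F := (S i 1).+1.
pose s : R := Num.sqrt 2; rewrite -/s.
have s0 : 0 <= s by apply: sqrtr_ge0.
have s2 : s ^+ 2 = 2 by rewrite sqr_sqrtr.
have s1 : 1 <= s by nra.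
pose G : R := s * F%:R - 2^-1.
have F1 : 1 <= F%:R :> R by rewrite ler1n.
have G0 : 0 <= G by rewrite /G; nra.
have Ghalf : - 2^-1 <= G by lra.
pose a j := (\sum_(k < L j) (S j k.+1 < F))%N.
pose y j := (L j - a j)%N.
have nowait j k : (k < L j)%N -> S j k.+1 = (S j 1 + k * m)%N.
  exact: wlrl_nowait m1 L1 w0 hw.
have split_j j : P j -> [/\ (a j + y j = L j)%N, (1 <= a j)%N &
    (\sum_(k < L j | F <= S j k.+1) 2 * S j k.+1 <=
      2 * y j * F.-1 + m * y j * (y j).+1)%N].
  move=> Pj; have [|a' [y' [eL a1 ea hy]]] := @progression_split m F (S j 1) (L j) _ (L1 j).
    by rewrite ltnS.
  have eaj : a j = a'.
    by rewrite -ea; apply: eq_bigr => k _; rewrite nowait.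
  have eyj : y j = y' by rewrite /y eaj -eL addKn.
  rewrite eaj eyj; split=> //; apply: leq_trans hy; apply: eq_leq.
  by apply: eq_big => [k|k _]; rewrite nowait.
have busy : F%:R <= \sum_(j | P j) (a j)%:R :> R.
  apply: covered_sum_ge => t; rewrite ltnS => ti.
  by have [j Pj hj] := wlrl_prefix_busy L1 hw ti; exists j.
have early : \sum_(j | P j) \sum_(k < L j | (S j k.+1 < F)%N) 2 * (S j k.+1)%:R
             <= F%:R * (F%:R - 1) :> R.
  have f0 t : 0 <= 2 * t%:R :> R by rewrite mulr_ge0.
  apply: le_trans (distinct_sum_le P F hS f0) _.
  elim: {+}F => [|T IHT]; first by rewrite big_ord0 mul0r.
  by rewrite big_ord_recr /= -natr1; lra.
have cost_S : \sum_(j | P j) 2 * ((L j)%:R * (job_completion m L S j)%:R) <=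
    \sum_(j | P j) (2 * (y j)%:R * (F%:R - 1) + (m * y j * (y j).+1)%:R
      + (m * L j * (L j).+1)%:R) + F%:R * (F%:R - 1) :> R.
  rewrite -lerBlDl; apply: le_trans early; rewrite lerBlDl -big_split /=.
  apply: ler_sum => j Pj; have [_ _ hy] := split_j j Pj.
  rewrite -natrM -(natrM _ 2) (length_completion_nowait (nowait j)) natrD addrAC lerD2r.
  rewrite natr_sum (bigID (fun k : 'I_(L j) => (S j k.+1 < F)%N)) /= addrC lerD //.
    under eq_bigl => k do rewrite -leqNgt.
    move: hy; rewrite -(ler_nat R) natr_sum natrD => hy; apply: le_trans hy _.
    have FE : F.-1%:R = F%:R - 1 :> R by rewrite /F /= -natr1 addrK.
    by rewrite lerD2r !natrM FE.
  by apply: ler_sum => k _; rewrite natrM.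
have cost_S' := schedule_length_cost_ge P hS' Ghalf.
have slack : 0 <= \sum_(j | P j) ((1 + s) * (y j)%:R * G
       + (1 + s) * \sum_(k < L j) Num.max 0 ((k * m)%:R - G)
       + (s - 1) / 2 * (m * L j * (L j).+1)%:R
       - (2 * (y j)%:R * (F%:R - 1) + (m * y j * (y j).+1)%:R)
       - (s - 1) / 2 * (a j)%:R).
  apply: sumr_ge0 => j Pj; have [eL a1 _] := split_j j Pj.
  by have := @job_slack R s G m (a j) (y j) F s0 s2 m1 a1 erefl; rewrite eL.
(* G >= 0 makes the coefficient nonnegative. *)
have scaled : ((1 + s) * G + (s - 1) / 2) * F%:R <=
              ((1 + s) * G + (s - 1) / 2) * \sum_(j | P j) (a j)%:R.
  by apply: ler_wpM2l => //; apply: addr_ge0; [apply: mulr_ge0|]; lra.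
(* With this G, the terms that depend on F only cancel. *)
have GF : (1 + s) * G + (s - 1) / 2 = (2 + s) * F%:R - 1.
  by rewrite /G -{3}s2; field.
have GE : (G + 2^-1) ^+ 2 = 2 * F%:R ^+ 2 by rewrite /G subrK exprMn s2.
rewrite GE in cost_S'; rewrite {1}GF in scaled.
have recombine : \sum_(j | P j) ((1 + s) * (y j)%:R * G
       + (1 + s) * \sum_(k < L j) Num.max 0 ((k * m)%:R - G)
       + (s - 1) / 2 * (m * L j * (L j).+1)%:R
       - (2 * (y j)%:R * (F%:R - 1) + (m * y j * (y j).+1)%:R)
       - (s - 1) / 2 * (a j)%:R)
   + ((1 + s) * G + (s - 1) / 2) * \sum_(j | P j) (a j)%:R
   = (1 + s) / 2 * \sum_(j | P j) (2 * (L j)%:R * G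
      + 2 * \sum_(k < L j) Num.max 0 ((k * m)%:R - G)
      + (m * L j * (L j).+1)%:R)
   - \sum_(j | P j) (2 * (y j)%:R * (F%:R - 1) + (m * y j * (y j).+1)%:R
      + (m * L j * (L j).+1)%:R).
  rewrite !mulr_sumr -sumrB -big_split /=; apply: eq_bigr => j Pj.
  have [eL _ _] := split_j j Pj.
  have -> : (L j)%:R = (a j)%:R + (y j)%:R :> R by rewrite -natrD eL.
  by field.
have c0 : 0 <= (1 + s) / 2 by lra.
have := ler_wpM2l c0 cost_S'; rewrite mulrBr => {}cost_S'.
rewrite -!mulr_sumr in cost_S cost_S'.
move: slack scaled recombine cost_S cost_S'.
rewrite /P /=.
set X1 := \sum_(j | _) (_ - _ * _); set X2 := (X in _ <= _ * X).
set X3 := \sum_(j | _) (_ + _); set X4 := \sum_(j | _) (_ + _).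
set X5 := (X in 2 * X <= _); set X6 := (X in _ <= _ * (2 * X)).
rewrite -/X1 -/X2 -/X3 -/X4 -/X5 -/X6.
nra.
Qed.

(** * Arbitrary weights *)

(** Summation by parts, as an induction on a bound T for b: the sum of rho D over
    b < T dominates r times the sum of D, for every lower bound r >= 0 of the
    values of rho there. *)
Lemma weighted_sum_ge0_of_prefix (R : realType) (n : nat) (b : 'I_n -> nat)
    (rho D : 'I_n -> R) :
  (forall j, 0 <= rho j) ->
  (forall i j, (b i <= b j)%N -> rho j <= rho i) ->
  (forall i, 0 <= \sum_(j | (b j <= b i)%N) D j) ->
  0 <= \sum_j rho j * D j.
Proof.
move=> rho0 rho_mono prefix0.
suff main T : forall r : R, 0 <= r -> (forall j, (b j < T)%N -> r <= rho j) ->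
    r * \sum_(j | (b j < T)%N) D j <= \sum_(j | (b j < T)%N) rho j * D j.
  have <- : \sum_(j | (b j < (\max_i b i).+1)%N) rho j * D j = \sum_j rho j * D j.
    by apply: eq_bigl => j; rewrite ltnS leq_bigmax.
  by have := main (\max_i b i).+1 0 (lexx 0) (fun j _ => rho0 j); rewrite mul0r.
elim: T => [|T IHT] r r0 hr; first by rewrite !big_pred0 ?mulr0.
have splitT (E : 'I_n -> R) : \sum_(j | (b j < T.+1)%N) E j =
    \sum_(j | (b j < T)%N) E j + \sum_(j | b j == T) E j.
  rewrite (bigID (fun j => (b j < T)%N)) /=; congr (_ + _); apply: eq_bigl => j; lia.
case: (pickP (fun i => b i == T)) => [i /eqP bi|none]; last first.
  have noneT (E : 'I_n -> R) : \sum_(j | b j == T) E j = 0 by rewrite big_pred0.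
  rewrite !splitT !noneT !addr0; apply: IHT => // j hj.
  by apply: hr; lia.
have hi : rho i * \sum_(j | (b j < T.+1)%N) D j <=
          \sum_(j | (b j < T.+1)%N) rho j * D j.
  rewrite !splitT mulrDr lerD //.
    by apply: IHT => // j hj; apply: rho_mono; lia.
  rewrite mulr_sumr; apply: ler_sum => j /eqP bj.
  have -> // : rho j = rho i.
  by apply/le_anti/andP; split; apply: rho_mono; rewrite bi bj.
apply: le_trans hi; apply: ler_wpM2r; last by apply: hr; rewrite bi.
by have := prefix0 i; rewrite bi; under eq_bigl => j do rewrite -ltnS.
Qed.

(** The cost depends only on the job completion times, and since all weights are
    positive only finitely many vectors of completion times cost at most as
    much as S0. *)
Lemma optimal_schedule_exists (R : realType) (n m : nat) (L : 'I_n -> nat)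
    (w : 'I_n -> R) (S0 : 'I_n -> nat -> nat) :
  (forall j, 0 < w j) -> is_schedule m L S0 ->
  exists S, optimal_schedule m L w S.
Proof.
move=> w0 hS0.
pose C0 := weighted_completion m L w S0.
pose K := (\max_(j < n) Num.bound (C0 / w j))%N.
have C_ge0 S : 0 <= weighted_completion m L w S.
  by apply: sumr_ge0 => j _; rewrite mulr_ge0 // ltW.
have bounded S j : weighted_completion m L w S <= C0 ->
    (job_completion m L S j < K.+1)%N.
  move=> hC; rewrite ltnS; apply: leq_trans (leq_bigmax j).
  rewrite -(ler_nat R); apply: le_trans (ltW (archi_boundP _)); last first.
    by rewrite divr_ge0 ?C_ge0 // ltW.
  rewrite ler_pdivlMr // mulrC; apply: le_trans hC.
  rewrite /weighted_completion (bigD1 j) //= lerDl.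
  by apply: sumr_ge0 => i _; rewrite mulr_ge0 // ltW.
pose vec S : {ffun 'I_n -> 'I_K.+1} := [ffun j => inord (job_completion m L S j)].
pose attained (f : {ffun 'I_n -> 'I_K.+1}) := `[< exists S, is_schedule m L S /\
  forall j, job_completion m L S j = f j >].
pose cost (f : {ffun 'I_n -> 'I_K.+1}) := \sum_j w j * (f j)%:R.
have vecP S : is_schedule m L S -> weighted_completion m L w S <= C0 ->
    attained (vec S) /\ cost (vec S) = weighted_completion m L w S.
  move=> hS hC; have vE j : vec S j = job_completion m L S j :> nat.
    by rewrite ffunE inordK // bounded.
  split; first by apply/asboolP; exists S; split.
  by apply: eq_bigr => j _; rewrite vE.
have [att0 cost0] := vecP S0 hS0 (lexx _).
case: (arg_minP cost att0) => f /asboolP[S [hS SE]] fmin.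
have costS : weighted_completion m L w S = cost f.
  by apply: eq_bigr => j _; rewrite SE.
exists S; split=> // S' hS'.
have [hC|hC] := lerP (weighted_completion m L w S') C0.
  by have [att <-] := vecP S' hS' hC; rewrite costS; apply: fmin.
by rewrite costS; apply: le_trans (ltW hC); rewrite /C0 -cost0; apply: fmin.
Qed.

Theorem theorem4p17 (R : realType) (m n : nat) (L : 'I_n -> nat)
    (w : 'I_n -> R) (hm : (1 <= m)%N) (hL : forall j, (1 <= L j)%N)
    (hw : forall j, 0 < w j) (sigma : 'I_n -> nat -> nat)
    (hsigma : wlrl_schedule m L w sigma) :
  exists2 sigma_opt : 'I_n -> nat -> nat,
    optimal_schedule m L w sigma_opt &
    weighted_completion m L w sigma
      <= (1 + Num.sqrt 2) / 2 * weighted_completion m L w sigma_opt.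
Proof.
have [S hS] := optimal_schedule_exists hw hsigma.1.
exists S => //; rewrite -subr_ge0 /weighted_completion mulr_sumr -sumrB.
pose D j : R := (1 + Num.sqrt 2) / 2 * ((L j)%:R * (job_completion m L S j)%:R)
  - (L j)%:R * (job_completion m L sigma j)%:R.
have -> : \sum_j ((1 + Num.sqrt 2) / 2 * (w j * (job_completion m L S j)%:R)
    - w j * (job_completion m L sigma j)%:R) = \sum_j w j / (L j)%:R * D j.
  apply: eq_bigr => j _; rewrite /D; have : (L j)%:R != 0 :> R.
    by rewrite pnatr_eq0 -lt0n.
  by move=> Lj; field.
apply: (@weighted_sum_ge0_of_prefix R n (fun j => sigma j 1)) => [j|i j ij|i].
- by rewrite divr_ge0 // ltW.
- exact: wlrl_ratio_sorted hL hsigma ij.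
rewrite /D sumrB -mulr_sumr subr_ge0.
exact: wlrl_prefix_length_cost hm hL hw hsigma hS.1.
Qed.
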